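(* Let $X$ be a metric space and let $\mathcal{A}$ be a qi-characteristic collection of subspaces of $X$. If $G$ is a finitely generated group quasi-isometric to $X$, then there is a finite collection $\mathcal{P}$ of subgroups of $G$ such that $(G,G/\mathcal{P})$ and $(X,\mathcal{A})$ are quasi-isometric pairs.
   Context: A finitely generated group is equipped with a word metric with respect to a finite generating set (left-invariant). $\mathsf{hdist}$ denotes Hausdorff distance (possibly infinite). For a collection $\mathcal{P}$ of subgroups of $G$, $G/\mathcal{P}$ is the set of left cosets $gP$ with $g\in G$, $P\in\mathcal{P}$, viewed as a collection of subspaces of $G$. A map $q\colon X\to Y$ of metric spaces is $(L,C)$-coarse Lipschitz if $\mathsf{dist}(q(x),q(y))\le L\,\mathsf{dist}(x,y)+C$ for all $x,y$. It is an $(L,C)$-quasi-isometry if it is $(L,C)$-coarse Lipschitz and there is an $(L,C)$-coarse Lipschitz map $\bar q\colon Y\to X$ with $\mathsf{dist}(\bar q q(x),x)\le C$ and $\mathsf{dist}(q\bar q(y),y)\le C$ for all $x\in X$, $y\in Y$. Let $\mathcal{A}$, $\mathcal{B}$ be collections of subspaces of $X$, $Y$. An $(L,C)$-quasi-isometry $q\colon X\to Y$ is an $(L,C,M)$-quasi-isometry of pairs $q\colon(X,\mathcal{A})\to(Y,\mathcal{B})$ if for every $A\in\mathcal{A}$ there is $B\in\mathcal{B}$ with $\mathsf{hdist}_Y(q(A),B)<M$, and for every $B\in\mathcal{B}$ there is $A\in\mathcal{A}$ with $\mathsf{hdist}_Y(q(A),B)<M$. The pairs are quasi-isometric if there is such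 a $q$ for some $L,C$ and $M>0$. A collection $\mathcal{A}$ of subspaces of $X$ is qi-characteristic if: (1) for any $L\ge1$, $C\ge0$ there is $M=M(L,C)>0$ such that any $(L,C)$-quasi-isometry $q\colon X\to X$ is an $(L,C,M)$-quasi-isometry of pairs $(X,\mathcal{A})\to(X,\mathcal{A})$; (2) every bounded subset of $X$ intersects only finitely many non-coarsely equivalent elements of $\mathcal{A}$, where $A,A'\in\mathcal{A}$ are coarsely equivalent if $\mathsf{hdist}(A,A')<\infty$; (3) for any $A\in\mathcal{A}$ the set $\{A'\in\mathcal{A}:\mathsf{hdist}(A,A')<\infty\}$ is bounded as a subspace of $(\mathcal{A},\mathsf{hdist})$. *)

(* Defs.v *)
From HB Require Import structures.
From mathcomp Require Import all_boot all_order all_algebra.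
From mathcomp Require Import all_classical all_reals all_analysis.

Set Implicit Arguments.
Unset Strict Implicit.
Unset Printing Implicit Defensive.
Import Order.TTheory GRing.Theory Num.Theory.

Local Open Scope classical_set_scope.
Local Open Scope ring_scope.

Section CoarseGeometry.
Context {R : realType}.
Implicit Types X Y : metricType R.

Definition thickening X (r : R) (A : set X) : set X :=
  [set x | exists2 a, A a & mdist x a <= r].

(* The infimum of the empty set is +oo: this is the value of hdist at sets that
   lie in no thickening of one another. *)
Definition hdist X (A B : set X) : \bar R :=
  ereal_inf [set r%:E | r in
    [set r : R | [/\ 0 <= r, A `<=` thickening r B & B `<=` thickening r A]]].

Definition coarse_lipschitz X Y (L C : R) (q : X -> Y) : Prop :=
  forall x y, mdist (q x) (q y) <= L * mdist x y + C.

Definition quasi_isometry X Y (L C : R) (q : X -> Y) : Prop :=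
  coarse_lipschitz L C q /\
  exists q' : Y -> X,
    [/\ coarse_lipschitz L C q',
        forall x, mdist (q' (q x)) x <= C
      & forall y, mdist (q (q' y)) y <= C].

Definition quasi_isometric X Y : Prop :=
  exists (L C : R) (q : X -> Y), quasi_isometry L C q.

Definition qi_of_pairs X Y (L C M : R)
    (AA : set (set X)) (BB : set (set Y)) (q : X -> Y) : Prop :=
  [/\ quasi_isometry L C q,
      forall A, AA A -> exists2 B, BB B & (hdist (q @` A) B < M%:E)%E
    & forall B, BB B -> exists2 A, AA A & (hdist (q @` A) B < M%:E)%E].

Definition quasi_isometric_pairs X Y (AA : set (set X)) (BB : set (set Y)) :
    Prop :=
  exists (L C M : R) (q : X -> Y), 0 < M /\ qi_of_pairs L C M AA BB q.

Definition dist_bounded X (U : set X) : Prop :=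
  exists r : R, forall x y, U x -> U y -> mdist x y <= r.

Definition coarsely_equivalent X (A B : set X) : Prop := (hdist A B < +oo)%E.

Definition coarse_class X (AA : set (set X)) (A : set X) : set (set X) :=
  [set A' | AA A' /\ coarsely_equivalent A A'].

(* The second condition counts the elements of AA that meet U up to coarse
   equivalence, through their classes. *)
Definition qi_characteristic X (AA : set (set X)) : Prop :=
  [/\ forall L C : R, 1 <= L -> 0 <= C ->
        exists2 M : R, 0 < M &
          forall q : X -> X, quasi_isometry L C q -> qi_of_pairs L C M AA AA q,
      forall U : set X, dist_bounded U ->
        finite_set
          [set coarse_class AA A | A in [set A | AA A /\ A `&` U !=set0]]
    & forall A, AA A ->
        exists D : R, forall A1 A2,
          coarse_class AA A A1 -> coarse_class AA A A2 ->
          (hdist A1 A2 <= D%:E)%E].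

End CoarseGeometry.

Section WordMetric.
Local Open Scope group_scope.
Variable G : groupType.

Definition is_subgroup (P : set G) : Prop := group_closed [in P].

Definition left_cosets (PP : set (set G)) : set (set G) :=
  [set A | exists (g : G) (P : set G), PP P /\ A = [set g * h | h in P]].

Record fin_gen_set := FinGenSet {
  gens :> set G;
  gens_finite : finite_set gens;
  gens_generate : smallest is_subgroup gens = [set: G] }.

Definition spelled (S : set G) (g : G) (n : nat) : Prop :=
  exists w : seq G, [/\ size w = n,
    forall x, x \in w -> S x \/ S x^-1 & \prod_(x <- w) x = g].

Lemma spelled0 S : spelled S 1 0.
Proof. by exists [::]; split=> //; rewrite big_nil. Qed.

Lemma spelledM S g h m n :
  spelled S g m -> spelled S h n -> spelled S (g * h) (m + n)%N.
Proof.
move=> [u [<- uS <-]] [v [<- vS <-]]; exists (u ++ v).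
split; [by rewrite size_cat| |by rewrite big_cat].
by move=> x; rewrite mem_cat => /orP[/uS|/vS].
Qed.

Lemma spelledV S g n : spelled S g n -> spelled S g^-1 n.
Proof.
move=> [w [<- wS <-]] {g n}; elim: w wS => [|x w IHw] wS.
  by rewrite big_nil invg1; apply: spelled0.
rewrite big_cons invgM /= -addn1; apply: spelledM.
  by apply: IHw => y yw; apply: wS; rewrite inE yw orbT.
exists [:: x^-1]; split=> //; last by rewrite big_seq1.
by move=> y; rewrite inE => /eqP ->; rewrite invgK or_comm; apply/wS/mem_head.
Qed.

Lemma spelled_ex (S : fin_gen_set) g : exists n, `[< spelled S g n >].
Proof.
pose H := [set h | exists n, spelled S h n].
suff : [set: G] `<=` H by move=> /(_ g I) [n nP]; exists n; apply/asboolP.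
rewrite -(gens_generate S); apply: smallest_sub => [|x Sx].
  split=> [|x y]; rewrite !inE; first by exists 0; apply: spelled0.
  move=> [m xm] [n yn]; exists (m + n)%N.
  exact/spelledM/spelledV.
exists 1%N, [:: x]; split=> //; last by rewrite big_seq1.
by move=> y; rewrite inE => /eqP ->; left.
Qed.

Definition word_length (S : fin_gen_set) (g : G) : nat :=
  ex_minn (spelled_ex S g).

Lemma word_lengthP (S : fin_gen_set) g : spelled S g (word_length S g).
Proof. by rewrite /word_length; case: ex_minnP => n /asboolP. Qed.

Lemma word_length_min (S : fin_gen_set) g n :
  spelled S g n -> (word_length S g <= n)%N.
Proof.
by rewrite /word_length; case: ex_minnP => m _ + gn; apply; apply/asboolP.
Qed.

(* The parameters R and S are there to key the metric structure below. *)
Definition word_metric (R : realType) (S : fin_gen_set) : Type := G.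

Section Metric.
Variables (R : realType) (S : fin_gen_set).

HB.instance Definition _ := Choice.on (word_metric R S).

Definition word_dist (g h : word_metric R S) : R :=
  (word_length S ((g : G)^-1 * (h : G)))%:R.

Let word_distxx g : word_dist g g = 0%R.
Proof.
rewrite /word_dist mulVg; apply/eqP; rewrite pnatr_eq0 -leqn0.
exact/word_length_min/spelled0.
Qed.

Let word_dist_positivity g h : word_dist g h = 0%R -> g = h.
Proof.
move=> /eqP; rewrite pnatr_eq0 => /eqP gh0.
have := word_lengthP S ((g : G)^-1 * (h : G)); rewrite gh0.
move=> [[|x w] [] //= _ _]; rewrite big_nil => gh1.
by apply: (mulgI (g : G)^-1); rewrite -gh1 mulVg.
Qed.

Let word_dist_sym g h : word_dist g h = word_dist h g.
Proof.
have le (x y : G) : (word_length S (x^-1 * y) <= word_length S (y^-1 * x))%N.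
  apply: word_length_min; rewrite -[x^-1 * y]invgK.
  by apply: spelledV; rewrite invgM invgK; apply: word_lengthP.
by congr (_%:R)%R; apply/eqP; rewrite eqn_leq !le.
Qed.

Let word_dist_triangle h g k :
  (word_dist g k <= word_dist g h + word_dist h k)%R.
Proof.
rewrite -natrD ler_nat; apply: word_length_min.
have -> : (g : G)^-1 * k = ((g : G)^-1 * h) * ((h : G)^-1 * k).
  by rewrite mulgA mulgK.
by apply: spelledM; apply: word_lengthP.
Qed.

HB.instance Definition _ := isMetric.Build R (word_metric R S)
  word_distxx word_dist_positivity word_dist_sym word_dist_triangle.

End Metric.
End WordMetric.

(* Main.v *)
(* Transport A along a quasi-inverse X -> G to a collection B of subsets of G.
   Left translations of G become uniform quasi-isometries of X, so by the first
   condition each translate of an element of B is uniformly close to an element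
   of B: G acts on the coarse classes of B, and by the second condition only
   finitely many classes come near 1, so there are finitely many orbits.  For
   P the collection of the stabilizers of representatives of these classes, it
   remains to see that the stabilizer of B is at finite Hausdorff distance from
   B: it is near B by the third condition, and conversely if b and b1 are points
   of B for which b^-1 B and b1^-1 B are in the same class, then b b1^-1
   stabilizes B; by the second condition finitely many b1 suffice. *)

Require Import Defs.
From mathcomp Require Import all_boot all_order all_algebra.
From mathcomp Require Import all_classical all_reals all_analysis.

Set Implicit Arguments.
Unset Strict Implicit.
Unset Printing Implicit Defensive.
Import Order.TTheory GRing.Theory Num.Theory.

Local Open Scope classical_set_scope.
Local Open Scope ring_scope.

(** Merges constants found separately for each of finitely many coarse classes: monotonicity of [P]
    lets their maximum serve all of them. *)
Lemma finite_set_uniform_bound (R : realType) (T : choiceType) (F : set T)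
    (P : T -> R -> Prop) :
  finite_set F ->
  (forall c k l, k <= l -> P c k -> P c l) ->
  (forall c, F c -> exists k, P c k) ->
  exists k, forall c, F c -> P c k.
Proof.
move=> /finite_seqP[s ->] Pmono; elim: s => [|c s IHs] Pex; first by exists 0.
have [k kP] : exists k, forall c, [set` s] c -> P c k.
  by apply: IHs => d /= ds; apply: Pex; rewrite /= inE ds orbT.
have [l lP] := Pex c (mem_head c s).
exists (Num.max k l) => d /=; rewrite inE => /predU1P[->|ds].
  by apply: Pmono lP; rewrite le_max lexx orbT.
by apply: Pmono (kP _ ds); rewrite le_max lexx.
Qed.

(** * Hausdorff closeness at an explicit radius *)

Section HausdorffClose.
Context {R : realType}.
Implicit Types X Y : metricType R.

(** An attained real radius replaces the infimum in [hdist], so that estimates simply add up; only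
    the return to [hdist] needs some strict slack. *)
Definition hclose {X} (r : R) (A B : set X) : Prop :=
  A `<=` thickening r B /\ B `<=` thickening r A.

Lemma hclose_sym X r (A B : set X) : hclose r A B -> hclose r B A.
Proof. by case. Qed.

Lemma hclose_le X r s (A B : set X) : r <= s -> hclose r A B -> hclose s A B.
Proof.
move=> rs [AB BA]; split=> x => [/AB|/BA] [y yS xy]; exists y => //;
  exact: le_trans xy rs.
Qed.

Lemma hclose_trans X r s (B A C : set X) :
  hclose r A B -> hclose s B C -> hclose (r + s) A C.
Proof.
move=> [AB BA] [BC CB]; split=> x.
  move=> /AB[y /BC[z Cz yz] xy]; exists z => //.
  by apply: le_trans (metric_triangle _ y _) (lerD _ _).
move=> /CB[y /BA[z Cz yz] xy]; exists z => //.
by rewrite addrC; apply: le_trans (metric_triangle _ y _) (lerD _ _).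
Qed.

Lemma hclose_image X Y (L C r : R) (f : X -> Y) (A B : set X) :
  0 <= L -> coarse_lipschitz L C f ->
  hclose r A B -> hclose (L * r + C) (f @` A) (f @` B).
Proof.
move=> L0 fLC [AB BA]; split=> _ [x + <-] => [/AB|/BA] [y yS xy];
  (exists (f y); first by exists y);
  apply: le_trans (fLC x y) _; by rewrite lerD2r ler_wpM2l.
Qed.

Lemma hclose_image_id X (C : R) (f : X -> X) (A : set X) :
  (forall x, mdist (f x) x <= C) -> hclose C (f @` A) A.
Proof.
move=> fC; split=> [_ [x Ax <-]|x Ax]; first by exists x.
by exists (f x); [exists x|rewrite metric_sym].
Qed.

Lemma hdist_lt_hclose X (r : R) (A B : set X) :
  (hdist A B < r%:E)%E -> hclose r A B.
Proof.
move=> /ereal_inf_lt[_ [s [_ AB BA] <-]]; rewrite lte_fin => /ltW sr.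
by apply: hclose_le sr _; split.
Qed.

Lemma hclose_hdist_lt X (r s : R) (A B : set X) :
  0 < s -> r < s -> hclose r A B -> (hdist A B < s%:E)%E.
Proof.
move=> s0 rs AB.
(* If both sets are empty, [r] may be negative, while the radii in [hdist] are nonnegative. *)
have [AB' BA'] : hclose (Num.max r 0) A B.
  by apply: hclose_le AB; rewrite le_max lexx.
apply: (@le_lt_trans _ _ (Num.max r 0)%:E); last by rewrite lte_fin gt_max rs.
by apply: ereal_inf_lbound; exists (Num.max r 0) => //; split=> //;
  rewrite le_max lexx orbT.
Qed.

Lemma coarsely_equivalentP X (A B : set X) :
  coarsely_equivalent A B <-> exists r, hclose r A B.
Proof.
split=> [/ereal_inf_lt[_ [r [_ AB BA] <-]] _|[r AB]].
  by exists r; split.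
apply: (@lt_trans _ _ (`|r| + 1)%:E); last exact: ltry.
apply: hclose_hdist_lt AB; first by rewrite ltr_wpDl.
by apply: le_lt_trans (ler_norm r) _; rewrite ltrDl.
Qed.

Lemma coarsely_equivalent_refl X (A : set X) : coarsely_equivalent A A.
Proof.
by apply/coarsely_equivalentP; exists 0; split=> x Ax; exists x => //;
  rewrite mdistxx.
Qed.

Lemma coarsely_equivalent_sym X (A B : set X) :
  coarsely_equivalent A B -> coarsely_equivalent B A.
Proof.
by move=> /coarsely_equivalentP[r /hclose_sym AB]; apply/coarsely_equivalentP;
  exists r.
Qed.

Lemma coarsely_equivalent_trans X (B A C : set X) :
  coarsely_equivalent A B -> coarsely_equivalent B C -> coarsely_equivalent A C.
Proof.
move=> /coarsely_equivalentP[r AB] /coarsely_equivalentP[s BC].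
by apply/coarsely_equivalentP; exists (r + s); apply: hclose_trans AB BC.
Qed.

Lemma coarsely_equivalent_image X Y (L C : R) (f : X -> Y) (A B : set X) :
  0 <= L -> coarse_lipschitz L C f ->
  coarsely_equivalent A B -> coarsely_equivalent (f @` A) (f @` B).
Proof.
move=> L0 fLC /coarsely_equivalentP[r AB]; apply/coarsely_equivalentP.
by exists (L * r + C); apply: hclose_image AB.
Qed.

Lemma coarse_class_refl X (AA : set (set X)) A : AA A -> coarse_class AA A A.
Proof. by move=> AAA; split=> //; apply: coarsely_equivalent_refl. Qed.

Lemma coarse_class_trans X (AA : set (set X)) B A C :
  coarse_class AA A B -> coarse_class AA A C -> coarse_class AA B C.
Proof.
move=> [_ AB] [AAC AC]; split=> //.
exact: coarsely_equivalent_trans (coarsely_equivalent_sym AB) AC.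
Qed.

Lemma coarse_lipschitz_weaken X Y (L C L' C' : R) (q : X -> Y) :
  L <= L' -> C <= C' -> coarse_lipschitz L C q -> coarse_lipschitz L' C' q.
Proof.
move=> LL CC qLC x y; apply: le_trans (qLC x y) (lerD _ CC).
by apply: ler_wpM2r LL; apply: mdist_ge0.
Qed.

Lemma coarse_lipschitz_comp X Y (Z : metricType R) (L C L' C' : R)
    (f : X -> Y) (g : Y -> Z) :
  0 <= L' -> coarse_lipschitz L C f -> coarse_lipschitz L' C' g ->
  coarse_lipschitz (L' * L) (L' * C + C') (g \o f).
Proof.
move=> L0 fLC gLC x y; apply: le_trans (gLC _ _) _.
by rewrite addrA lerD2r -mulrA -mulrDr ler_wpM2l.
Qed.

End HausdorffClose.

(** * Left translations and coarse stabilizers in the word metric *)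

Section Translations.
Variables (R : realType) (G : groupType) (S : fin_gen_set G).
Let W : metricType R := word_metric R S.
Implicit Types (g h : G) (B : set W).

Definition ltranslate g (x : W) : W := (g * (x : G))%g.

Lemma mdist_ltranslate g (x y : W) :
  mdist (ltranslate g x) (ltranslate g y) = mdist x y.
Proof.
rewrite /mdist /= /word_dist /ltranslate; congr (word_length S _)%:R.
by rewrite invgM -mulgA mulKg.
Qed.

Lemma coarse_lipschitz_ltranslate g : coarse_lipschitz 1 0 (ltranslate g).
Proof. by move=> x y; rewrite mdist_ltranslate mul1r addr0. Qed.

Lemma ltranslateM g h (x : W) :
  ltranslate g (ltranslate h x) = ltranslate (g * h)%g x.
Proof. exact: mulgA. Qed.

Lemma ltranslate1 (x : W) : ltranslate 1%g x = x.
Proof. exact: mul1g. Qed.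

Lemma ltranslate_setM g h B :
  ltranslate g @` (ltranslate h @` B) = ltranslate (g * h)%g @` B.
Proof. by rewrite image_comp; apply: eq_imagel => x _ /=; apply: ltranslateM. Qed.

Lemma ltranslate_set1 B : ltranslate 1%g @` B = B.
Proof.
by rewrite -[RHS]image_id; apply: eq_imagel => x _; apply: ltranslate1.
Qed.

Lemma hclose_ltranslate g r (A B : set W) :
  hclose r A B -> hclose r (ltranslate g @` A) (ltranslate g @` B).
Proof.
move=> AB; rewrite -[r]mul1r -[1 * r]addr0.
exact: hclose_image (coarse_lipschitz_ltranslate g) AB.
Qed.

Lemma coarsely_equivalent_ltranslate g (A B : set W) :
  coarsely_equivalent A B ->
  coarsely_equivalent (ltranslate g @` A) (ltranslate g @` B).
Proof.
exact: coarsely_equivalent_image (coarse_lipschitz_ltranslate g).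
Qed.

(** Coarse equivalence replaces equality because a translate of an element of the collection is only
    close to another element. *)
Definition coarse_stabilizer B : set G :=
  [set g | coarsely_equivalent (ltranslate g @` B) B].

Lemma coarse_stabilizer_subgroup B : is_subgroup (coarse_stabilizer B).
Proof.
split=> [|g h]; rewrite !inE /coarse_stabilizer /=.
  by rewrite ltranslate_set1; apply: coarsely_equivalent_refl.
move=> gB hB; apply: coarsely_equivalent_trans gB.
rewrite -ltranslate_setM; apply: coarsely_equivalent_ltranslate.
apply: coarsely_equivalent_sym.
move: hB => /(coarsely_equivalent_ltranslate h^-1%g).
by rewrite ltranslate_setM mulVg ltranslate_set1.
Qed.

(** * Collections of subsets of [G] permuted by translations up to an error [m] *)

Section Stabilizers.
Variables (BB : set (set W)) (m : R).
Hypothesis BB_nonempty : forall B, BB B -> B !=set0.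
Hypothesis BB_translate : forall g B, BB B ->
  exists2 B', BB B' & hclose m (ltranslate g @` B) B'.
Let near1 B := exists2 b, B b & mdist (1%g : W) b <= m.
Let near_classes := [set coarse_class BB B | B in [set B | BB B /\ near1 B]].
Hypothesis BB_finite : finite_set near_classes.
Hypothesis BB_bounded : forall B, BB B ->
  exists D, forall B', coarse_class BB B B' -> hclose D B B'.

(** The translate by [b^-1] contains 1, so an element of [BB] that is [m]-close to it has a point
    within [m] of 1; hence the radius in [near1]. *)
Lemma translate_near1 B (b : W) : BB B -> B b ->
  exists B', [/\ BB B', near1 B' & hclose m (ltranslate (b : G)^-1%g @` B) B'].
Proof.
move=> BBB Bb; have [B' BBB' BB'] := BB_translate (b : G)^-1%g BBB.
exists B'; split=> //; have [+ _] := BB'; apply.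
by exists b => //; rewrite /ltranslate mulVg.
Qed.

Lemma hclose_coarse_stabilizer B : BB B ->
  exists K, hclose K (coarse_stabilizer B : set W) B.
Proof.
move=> BBB; have [b0 Bb0] := BB_nonempty BBB; have [D DB] := BB_bounded BBB.
(* The path goes from [p] to [p b0] by left invariance, then to [B'] at cost [m], then to [B] at
   cost [D]. *)
have stab_near : (coarse_stabilizer B : set W) `<=`
    thickening (mdist (1%g : W) b0 + m + D) B.
  move=> p pB; have [B' BBB' pBB'] := BB_translate p BBB.
  have /DB[_ B'B] : coarse_class BB B B'.
    split=> //; apply: coarsely_equivalent_trans (coarsely_equivalent_sym pB) _.
    by apply/coarsely_equivalentP; exists m.
  have [pBB'p _] := pBB'; have [|b' B'b' pb0b'] := pBB'p (ltranslate p b0).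
    by exists b0.
  have [b Bb b'b] := B'B b' B'b'; exists b => //.
  apply: le_trans (metric_triangle _ b' _) (lerD _ b'b).
  apply: le_trans (metric_triangle _ (ltranslate p b0) _) (lerD _ pb0b').
  by rewrite -(mdist_ltranslate p (1%g : W)) /ltranslate mulg1.
have near_stab : exists k, forall c, near_classes c -> forall b, B b ->
    forall B', BB B' -> hclose m (ltranslate (b : G)^-1%g @` B) B' ->
    coarse_class BB B' = c -> thickening k (coarse_stabilizer B : set W) b.
  apply: finite_set_uniform_bound => // [c k l kl kP b Bb B' BBB' bB' B'c|c _].
    have [p pB bp] := kP b Bb B' BBB' bB' B'c.
    by exists p => //; apply: le_trans bp kl.
  (* One [b1] is fixed for the class [c], so that the bound does not depend on [b]; if no point of
     [B] realizes [c], the claim is vacuous. *)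
  have [[b1 [B1 [Bb1 BBB1 bB1 B1c]]]|noc] :=
    pselect (exists b1 B1, [/\ B b1, BB B1,
      hclose m (ltranslate (b1 : G)^-1%g @` B) B1 & coarse_class BB B1 = c]);
    last by exists 0 => b Bb B' BBB' bB' B'c; case: noc; exists b, B'.
  exists (mdist b1 (1%g : W)) => b Bb B' BBB' bB' B'c.
  (* By left invariance the distance from [b] to [b b1^-1] is that from 1 to [b1^-1], hence from
     [b1] to 1. *)
  exists (ltranslate (b : G) (b1 : G)^-1%g : W); last first.
    rewrite -(mdist_ltranslate (b1 : G)^-1%g b1) /ltranslate mulVg mulg1.
    rewrite -(mdist_ltranslate b (1%g : W)).
    by rewrite /ltranslate mulg1.
  have B1B' : coarsely_equivalent B1 B'.
    by have [] : coarse_class BB B1 B' by rewrite B1c -B'c;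
      apply: coarse_class_refl.
  rewrite /coarse_stabilizer /=.
  (* With [B] written as [b (b^-1 B)], the factor [b] cancels; what remains is the chain [b1^-1 B],
     [B1], [B'], [b^-1 B]. *)
  rewrite -[X in coarsely_equivalent _ X]ltranslate_set1 -(mulgV (b : G)).
  rewrite -!ltranslate_setM.
  apply: coarsely_equivalent_ltranslate.
  apply: (coarsely_equivalent_trans (B := B1)).
    by apply/coarsely_equivalentP; exists m.
  apply: coarsely_equivalent_trans B1B' _.
  by apply/coarsely_equivalentP; exists m; apply: hclose_sym.
have [k kP] := near_stab.
exists (Num.max (mdist (1%g : W) b0 + m + D) k); split.
  move=> p /stab_near[b Bb pb]; exists b => //.
  by rewrite le_max pb.
move=> b Bb; have [B' [BBB' B'1 bB']] := translate_near1 BBB Bb.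
have [p pB bp] := kP (coarse_class BB B')
  (ex_intro2 _ _ B' (conj BBB' B'1) erefl) b Bb B' BBB' bB' erefl.
by exists p => //; rewrite le_max bp orbT.
Qed.

Lemma hclose_stabilizer_cosets :
  exists PP : set (set G),
    [/\ finite_set PP, forall P, PP P -> is_subgroup P
      & exists K,
        (forall Q : set W, left_cosets PP Q -> exists2 B, BB B & hclose K Q B) /\
        (forall B, BB B -> exists2 Q : set W, left_cosets PP Q & hclose K Q B)].
Proof.
(* The default [set0] is never returned on the class of an element of [BB], since that class
   contains the element. *)
pose rep (c : set (set W)) := xget set0 c.
have repP B : BB B -> coarse_class BB B (rep (coarse_class BB B)).
  by move=> BBB; apply: (xgetI set0); apply: coarse_class_refl.
have [K KP] : exists K, forall c, near_classes c ->
    hclose K (coarse_stabilizer (rep c) : set W) (rep c) /\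
    forall B, c B -> hclose K (rep c) B.
  apply: finite_set_uniform_bound => // [c k l kl [k1 k2]|_ [B [BBB _] <-]].
    split=> [|B cB]; first exact: hclose_le kl k1.
    exact: hclose_le kl (k2 B cB).
  have [BBr _] := repP B BBB; set C := rep _ in BBr *.
  have [K CK] := hclose_coarse_stabilizer BBr.
  have [D CD] := BB_bounded BBr.
  exists (Num.max K D); split.
    by apply: hclose_le CK; rewrite le_max lexx.
  move=> B' BB'; apply: (@hclose_le _ _ D); first by rewrite le_max lexx orbT.
  by apply: CD; apply: coarse_class_trans BB'; apply: repP.
exists [set coarse_stabilizer (rep c) | c in near_classes]; split.
- exact: finite_image.
- by move=> _ [c _ <-]; apply: coarse_stabilizer_subgroup.
(* For a coset: [K] from stabilizer to representative, [m] from its translate to [BB]. For an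
   element [B]: [K] to the representative, [K] to [B'], [m] to [b^-1 B]. *)
exists (Num.max (K + m) (K + K + m)); split.
  move=> _ [g [_ [[c cP <-] ->]]].
  have [cK _] := KP c cP.
  have BBc : BB (rep c) by case: cP => B [BBB _] <-; case: (repP B BBB).
  have [B' BBB' cB'] := BB_translate g BBc.
  exists B' => //; apply: (@hclose_le _ _ (K + m)); first by rewrite le_max lexx.
  by apply: hclose_trans cB'; apply: (hclose_ltranslate g).
move=> B BBB; have [b Bb] := BB_nonempty BBB.
have [B' [BBB' B'1 bB']] := translate_near1 BBB Bb.
have B'c : near_classes (coarse_class BB B') by exists B'.
have [K1 K2] := KP _ B'c.
exists (ltranslate (b : G) @` (coarse_stabilizer (rep (coarse_class BB B')))).
  exists (b : G), (coarse_stabilizer (rep (coarse_class BB B'))); split=> //.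
  by exists (coarse_class BB B').
rewrite -[X in hclose _ _ X]ltranslate_set1 -(mulgV (b : G)) -ltranslate_setM.
apply: hclose_ltranslate.
apply: (@hclose_le _ _ (K + K + m)); first by rewrite le_max lexx orbT.
apply: hclose_trans (hclose_sym bB').
by apply: hclose_trans K1 _; apply: K2; apply: coarse_class_refl.
Qed.

End Stabilizers.
End Translations.

(** * Transport between [X] and [G] *)

Unset Implicit Arguments.

Theorem theorem4p1 (R : realType) (X : metricType R) (AA : set (set X))
    (AA_nonempty : forall A, AA A -> A !=set0)
    (AA_char : qi_characteristic AA)
    (G : groupType) (S : fin_gen_set G)
    (GX : quasi_isometric (word_metric R S) X) :
  exists PP : set (set G),
    [/\ finite_set PP,
        forall P, PP P -> is_subgroup P
      & quasi_isometric_pairs (X := word_metric R S) (left_cosets PP) AA].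
Proof.
have [AA_qi AA_fin AA_bnd] := AA_char.
(* [quasi_isometric] puts no bounds on its constants, so they are enlarged to the range of the first
   condition. *)
have [L [C [q [L1 C0 [qLC [q' [q'LC q'q qq']]]]]]] :
    exists (L C : R) (q : word_metric R S -> X),
      [/\ 1 <= L, 0 <= C & quasi_isometry L C q].
  have [L [C [q [qLC [q' [q'LC q'q qq']]]]]] := GX.
  have LL : L <= Num.max L 1 by rewrite le_max lexx.
  have CC : C <= Num.max C 0 by rewrite le_max lexx.
  exists (Num.max L 1), (Num.max C 0), q.
  split; rewrite ?le_max ?lexx ?orbT//.
  split; first exact: coarse_lipschitz_weaken qLC.
  exists q'; split; first exact: coarse_lipschitz_weaken q'LC.
    by move=> x; apply: le_trans (q'q x) CC.
  by move=> y; apply: le_trans (qq' y) CC.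
have L0 : 0 <= L by apply: le_trans L1.
pose T A := q' @` A.
(* Translation by [g] conjugated to [X]; its constants do not depend on [g], so a single [M] serves
   all translations. *)
pose f g := q \o (@ltranslate R G S g \o q').
have f_lip g : coarse_lipschitz (L * (1 * L)) (L * (1 * C + 0) + C) (f g).
  apply: coarse_lipschitz_comp => //; apply: coarse_lipschitz_comp => //.
  exact: coarse_lipschitz_ltranslate.
(* Removing the inner [q' \o q] costs [C], which [q] turns into [L * C + C]; the last [C] compares
   [q (q' x)] with [x]. *)
have ff g x : mdist (f g^-1%g (f g x)) x <= L * C + C + C.
  apply: le_trans (metric_triangle _ (q (q' x)) _) (lerD _ (qq' x)).
  rewrite -[q' x in leLHS]ltranslate1 -(mulVg g) -ltranslateM.
  apply: le_trans (qLC _ _) _; rewrite mdist_ltranslate lerD2r.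
  by apply: ler_wpM2l => //; apply: q'q.
have f_qi g : quasi_isometry (L * L) (L * C + C + C) (f g).
  have lip h : coarse_lipschitz (L * L) (L * C + C + C) (f h).
    apply: coarse_lipschitz_weaken (f_lip h); first by rewrite mul1r.
    by rewrite mul1r addr0 lerDl.
  split=> //; exists (f g^-1%g); split=> // y.
  by rewrite -{1}(invgK g).
have [M M0 AA_M] : exists2 M : R, 0 < M & forall g,
    qi_of_pairs (L * L) (L * C + C + C) M AA AA (f g).
  have [||M M0 AA_M] := AA_qi (L * L) (L * C + C + C).
  - by rewrite -[1]mulr1 ler_pM.
  - by rewrite !addr_ge0// mulr_ge0.
  - by exists M => // g; apply: AA_M.
(* The first [C] removes [q' \o q] from the translate of [T A]; [L * M + C] is the image under [q']
   of closeness at radius [M]. *)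
pose m := C + (L * M + C).
have T_translate g A : AA A ->
    exists2 A', AA A' & hclose m (@ltranslate R G S g @` T A) (T A').
  move=> AAA; have [_ /(_ A AAA)[A' AAA' AA'] _] := AA_M g.
  exists A' => //; move: AA' => /hdist_lt_hclose.
  move=> /(hclose_image L0 q'LC); apply: hclose_trans.
  have -> : q' @` (f g @` A) = (q' \o q) @` (@ltranslate R G S g @` T A).
    by rewrite /T !image_comp.
  exact/hclose_sym/hclose_image_id.
(* Coarse equivalence is reflected by [T] because [q @] T
   B[stays within]C[of]B[; conditions two and three thus pass to]T @[AA]. *)
have T_class A : AA A ->
    coarse_class (T @` AA) (T A) = T @` coarse_class AA A.
  move=> AAA; apply/seteqP; split.
    move=> _ [[A' AAA' <-] TAA']; exists A' => //; split=> //.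
    have qT B : coarsely_equivalent (q @` T B) B.
      apply/coarsely_equivalentP; exists C; rewrite /T image_comp.
      exact: hclose_image_id.
    apply: coarsely_equivalent_trans (qT A').
    apply: coarsely_equivalent_trans (coarsely_equivalent_sym (qT A)) _.
    exact: coarsely_equivalent_image L0 qLC TAA'.
  move=> _ [A' [AAA' AA'] <-]; split; first by exists A'.
  exact: coarsely_equivalent_image L0 q'LC AA'.
have [||||PP [PP_fin PP_grp [K [PPBB BBPP]]]] :=
  @hclose_stabilizer_cosets R G S (T @` AA) m.
- by move=> _ [A /AA_nonempty[a Aa] <-]; exists (q' a), a.
- move=> g _ [A AAA <-]; have [A' AAA' AA'] := T_translate g A AAA.
  by exists (T A') => //; exists A'.
(* If [q' a] is within [m] of 1, then [q (q' a)] is within [L * m + C] of [q 1], and [a] is within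
   [C] of [q (q' a)]. *)
- pose U := [set x | mdist (q 1%g) x <= L * m + C + C].
  have U_bnd : dist_bounded U.
    exists (L * m + C + C + (L * m + C + C)) => x y Ux Uy.
    by apply: le_trans (metric_triangle _ (q 1%g) _) (lerD _ Uy);
      rewrite metric_sym.
  have := finite_image (fun c => T @` c) (AA_fin U U_bnd).
  apply: sub_finite_set.
  move=> _ [_ [[A AAA <-] [_ [a Aa <-] a1]] <-].
  exists (coarse_class AA A); last by rewrite T_class.
  exists A => //; split=> //; exists a; split=> //; rewrite /U /=.
  apply: le_trans (metric_triangle _ (q (q' a)) _) (lerD _ (qq' a)).
  by apply: le_trans (qLC _ _) _; rewrite lerD2r ler_wpM2l.
- move=> _ [A AAA <-]; have [D AD] := AA_bnd A AAA.
  (* The third condition gives a weak inequality; adding 1 makes it strict, as [hdist_lt_hclose]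
     requires. *)
  exists (L * (D + 1) + C) => B'; rewrite T_class// => -[A' AA' <-].
  apply: hclose_image => //; apply: hdist_lt_hclose.
  apply: le_lt_trans (AD A A' _ AA') _; first exact: coarse_class_refl.
  by rewrite lte_fin ltrDl.
exists PP; split=> //.
(* No sign is known for [K]; the absolute value plus 1 is positive and strictly above the radius. *)
pose N := `|L * K + C + C| + 1.
have N0 : 0 < N by rewrite ltr_pwDr.
have qN (Q : set (word_metric R S)) A : hclose K Q (T A) ->
    (hdist (q @` Q) A < N%:E)%E.
  move=> QA; apply: (@hclose_hdist_lt _ _ (L * K + C + C)) => //.
    by apply: le_lt_trans (ler_norm _) _; rewrite ltrDl.
  apply: hclose_trans (hclose_image L0 qLC QA) _.
  by rewrite /T image_comp; apply: hclose_image_id.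
exists L, C, N, q; split=> //; split.
- by split=> //; exists q'.
- by move=> Q /PPBB[_ [A AAA <-] /qN]; exists A.
- move=> A AAA; have [|Q QP /qN] := BBPP (T A); first by exists A.
  by exists Q.
Qed.
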